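(* Let $G$ be a finite connected simple graph with $n$ vertices, and let $\kappa(G)$ be its number of spanning trees. The number of chip configurations debt-reachable from an arbitrary chip configuration with $c$ chips on $G$ is asymptotically equal to $$\frac{c^{n-1}}{(n-1)!\,\kappa(G)}$$ as $c\to\infty$. That is, if for each $c\ge 1$ we choose any chip configuration $X_c$ on $G$ with a total of $c$ chips, and $N(X_c)$ denotes the number of chip configurations debt-reachable from $X_c$, then $N(X_c)\big/\frac{c^{n-1}}{(n-1)!\,\kappa(G)}\to 1$ as $c\to\infty$.
   Context: Label the vertices of $G$ by $1,\dots,n$. A chip configuration on $G$ is an $n$-tuple of nonnegative integers $(c_1,\dots,c_n)$, with $c_i$ the number of chips on vertex $i$; its total number of chips is $c_1+\dots+c_n$. A (general) chip-firing move at vertex $i$, of degree $d_i$, subtracts $d_i$ chips from vertex $i$ and adds one chip to each vertex adjacent to $i$; no condition is imposed on the current number of chips on $i$, so intermediate tuples may have negative entries. A chip configuration $C'$ is debt-reachable from a chip configuration $C$ if some finite (possibly empty) sequence of general chip-firing moves transforms $C$ into $C'$; both $C$ and $C'$ must have nonnegative entries. *)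

(* Defs.v *)
From HB Require Import structures.
From mathcomp Require Import all_boot all_order all_algebra.
From mathcomp Require Import finmap.
From mathcomp Require Import all_classical all_reals all_analysis.

Set Implicit Arguments.
Unset Strict Implicit.
Unset Printing Implicit Defensive.

Import Order.TTheory GRing.Theory Num.Theory.
Import numFieldNormedType.Exports.

Local Open Scope ring_scope.

(* A simple graph on the vertex set 'I_n is a symmetric irreflexive relation;
   this is the standing hypothesis under which the definitions below are used. *)

Definition connected_graph (n : nat) (e : rel 'I_n) : Prop :=
  (0 < n)%N /\ forall i j : 'I_n, connect e i j.

Definition degree (n : nat) (e : rel 'I_n) (i : 'I_n) : nat := #|[set j | e i j]|.

Definition edges (n : nat) (e : rel 'I_n) : {set {set 'I_n}} :=
  [set A | [exists i, exists j, e i j && (A == [set i; j])]].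

Definition edge_rel (n : nat) (F : {set {set 'I_n}}) : rel 'I_n :=
  fun i j => [set i; j] \in F.

(* The bound on the size excludes i-j-i, which is a [ucycle] for every edge. *)
Definition acyclic (n : nat) (e : rel 'I_n) : Prop :=
  forall p : seq 'I_n, (2 < size p)%N -> ~ ucycle e p.

Definition spanning_tree (n : nat) (e : rel 'I_n) (F : {set {set 'I_n}}) : Prop :=
  [/\ F \subset edges e, connected_graph (edge_rel F) & acyclic (edge_rel F)].

Definition num_spanning_trees (n : nat) (e : rel 'I_n) : nat :=
  #|[set F : {set {set 'I_n}} | `[< spanning_tree e F >]]|.

Definition config (n : nat) := {ffun 'I_n -> nat}.

Definition total_chips (n : nat) (C : config n) : nat := (\sum_i C i)%N.

Definition int_config (n : nat) (C : config n) : {ffun 'I_n -> int} :=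
  [ffun i => (C i)%:Z].

Definition fire (n : nat) (e : rel 'I_n) (D : {ffun 'I_n -> int}) (i : 'I_n) :
    {ffun 'I_n -> int} :=
  [ffun j => D j - (if j == i then (degree e i)%:Z else 0)
                 + (if e i j then 1 else 0)].

(* The fired tuples range over int because intermediate entries may be
   negative; only the two end configurations are over nat. *)
Definition debt_reachable (n : nat) (e : rel 'I_n) (C C' : config n) : Prop :=
  exists s : seq 'I_n, foldl (fire e) (int_config C) s = int_config C'.

Definition num_debt_reachable (n : nat) (e : rel 'I_n) (C : config n) : nat :=
  #|` fset_set [set C' : config n | debt_reachable e C C']%classic |.

(* [fset_set] returns the empty set on infinite sets; [finite_debt_reachable]
   shows that this junk value is never used in [num_debt_reachable]. *)

Lemma sum_fire (n : nat) (e : rel 'I_n) (D : {ffun 'I_n -> int}) (i : 'I_n) :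
  \sum_j fire e D i j = \sum_j D j.
Proof.
under eq_bigr do rewrite ffunE.
rewrite big_split big_split /= sumrN -big_mkcond /= big_pred1_eq.
rewrite -big_mkcond /= sumr_const /degree cardsE -natz.
by rewrite -addrA addNr addr0.
Qed.

Lemma debt_reachable_total (n : nat) (e : rel 'I_n) (C C' : config n) :
  debt_reachable e C C' -> total_chips C' = total_chips C.
Proof.
have totZ (B : config n) : (total_chips B)%:Z = \sum_i int_config B i.
  rewrite /total_chips -natz natr_sum; apply: eq_bigr => i _; by rewrite ffunE natz.
have sumF s : forall D, \sum_i foldl (fire e) D s i = \sum_i D i.
  by elim: s => //= i s IHs D; rewrite IHs sum_fire.
by move=> [s /(congr1 (fun D : {ffun 'I_n -> int} => \sum_i D i))];
   rewrite sumF -!totZ => -[].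
Qed.

Lemma finite_debt_reachable (n : nat) (e : rel 'I_n) (C : config n) :
  finite_set [set C' : config n | debt_reachable e C C']%classic.
Proof.
pose f (g : {ffun 'I_n -> 'I_(total_chips C).+1}) : config n := [ffun i => g i : nat].
apply: (@sub_finite_set _ _ (range f)); last exact/finite_image/finite_finset.
move=> C' /= /debt_reachable_total eqC; exists [ffun i => inord (C' i)] => //.
apply/ffunP => i; rewrite !ffunE inordK // ltnS -eqC /total_chips (bigD1 i) //=.
exact: leq_addr.
Qed.

(* Main.v *)
Require Import Defs.
From HB Require Import structures.
From mathcomp Require Import all_boot all_order all_algebra.
From mathcomp Require Import finmap.
From mathcomp Require Import all_classical all_reals all_analysis.
From mathcomp Require Import zify ring.
From mathcomp Require Import fintype finset.

Set Implicit Arguments.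
Unset Strict Implicit.
Unset Printing Implicit Defensive.

Import Order.TTheory GRing.Theory Num.Theory.
Import numFieldNormedType.Exports.

(** Firing vertices, with debts allowed, moves a configuration within its class
    modulo the image of the graph Laplacian, so [N(X)] is the number of
    effective divisors linearly equivalent to [X]. The estimate rests on two
    facts: in every degree there are exactly [kappa(G)] classes, and classes of
    nearby degrees contain almost equally many effective divisors.

    The number of classes is found without determinants. Fix a vertex [q]. Every
    class of a given degree contains exactly one divisor that is [q]-reduced,
    that is, nonnegative outside [q] and given there by a parking function
    ([lin_equiv_reduced], [reduced_unique]). Dhar's burning process turns
    parking functions into spanning trees rooted at [q], presented by their
    parent maps, and back ([tree_parking_parking], [tree_parking_inj],
    [parking_tree_parking]); forgetting the direction of the edges identifies
    these with the spanning trees ([num_spanning_treesE]).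

    To compare classes, let [k = n - 1] and [M = n * n]. A divisor of degree at
    least [M] is equivalent to an effective one, since parking functions take
    values below [n]. Adding such an effective divisor embeds the effective
    part of any class of degree [c] in that of any class of degree [c + M]
    ([num_effective_le]). Summing over all the classes of degree [c + M], or
    of degree [c - M], whose effective divisors together are all the
    configurations with that number of chips, gives
    [C(c - M + k, k) <= kappa(G) N(X_c) <= C(c + M + k, k)]
    ([num_effective_bounds]). Both bounds are equivalent to [c ^ k / k!], and
    they do not depend on the choice of [X_c]. *)

(** * Rooted spanning trees and parking functions *)

Section ParkingFunctions.

Variables (V : finType) (e : rel V) (q : V).

Implicit Types (pi : {ffun V -> V}) (d f : V -> nat) (A : {set V}).

Definition depth_of pi d : Prop :=
  forall v, d v = if v == q then 0 else (d (pi v)).+1.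

(** A spanning tree rooted at [q] is encoded by its parent map; the existence
    of a depth function says that following parents leads to [q]. *)
Definition rooted_tree pi : Prop :=
  [/\ pi q = q, forall v, v != q -> e v (pi v) & exists d, depth_of pi d].

Definition depth pi : V -> nat := xget (fun=> 0) [set d | depth_of pi d]%classic.

Definition outdegree A v : nat := #|[set w | e v w & w \notin A]|.

Definition parking f : Prop :=
  forall A u, u \in A -> q \notin A -> exists2 v, v \in A & f v < outdegree A v.

Definition precedes d : rel V := fun u w =>
  (d u < d w) || (d u == d w) && (enum_rank u < enum_rank w).

Definition position d v w : nat := #|[set u | e v u & precedes d u w]|.

(** The parking function of a tree: [f v] counts the neighbours of [v] met
    before its parent in breadth-first order, so that in the burning process
    driven by [f] it is the parent of [v] whose burning ignites [v]. *)
Definition tree_parking pi v : nat :=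
  if v == q then 0 else position (depth pi) v (pi v).

Lemma depth_of_unique pi d d' : depth_of pi d -> depth_of pi d' -> d =1 d'.
Proof.
move=> dP d'P v; have [k] := ubnP (d v); elim: k v => // k IHk v.
rewrite ltnS dP d'P; case: ifP => // _ lt_k; congr _.+1.
exact: IHk.
Qed.

Lemma depthP pi : rooted_tree pi -> depth_of pi (depth pi).
Proof. by case=> _ _ exd; exact: (@xgetPex _ _ [set d | depth_of pi d]%classic). Qed.

Lemma depth_of_depth pi d : depth_of pi d -> depth pi = d.
Proof.
move=> dP; apply: funext; apply: depth_of_unique (dP).
by apply: (@xgetPex _ _ [set d | depth_of pi d]%classic); exists d.
Qed.

Lemma depth_root pi : rooted_tree pi -> depth pi q = 0.
Proof. by move=> /depthP ->; rewrite eqxx. Qed.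

Lemma depth_parent pi v : rooted_tree pi -> v != q -> depth pi v = (depth pi (pi v)).+1.
Proof. by move=> /depthP dP /negPf vq; rewrite {1}dP vq. Qed.

Lemma precedes_trans d : transitive (precedes d).
Proof.
move=> u v w /orP[lt1|/andP[/eqP eq1 lt1]] /orP[lt2|/andP[/eqP eq2 lt2]];
  rewrite /precedes.
- by rewrite (ltn_trans lt1 lt2).
- by rewrite -eq2 lt1.
- by rewrite eq1 lt2.
- by rewrite eq1 eq2 eqxx (ltn_trans lt1 lt2) orbT.
Qed.

Lemma precedes_irr d : irreflexive (precedes d).
Proof. by move=> v; rewrite /precedes !ltnn andbF. Qed.

Lemma precedes_total d u w : u != w -> precedes d u w || precedes d w u.
Proof.
move=> uw; rewrite /precedes; case: (ltngtP (d u) (d w)) => //= _.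
by rewrite -neq_ltn (inj_eq val_inj) (inj_eq enum_rank_inj).
Qed.

Lemma position_mono d v u w : e v u -> precedes d u w ->
  position d v u < position d v w.
Proof.
move=> vu uw; apply/proper_card/properP; split.
  apply/subsetP => x; rewrite !inE => /andP[-> xu] /=; exact: precedes_trans xu uw.
by exists u; rewrite !inE ?vu ?precedes_irr.
Qed.

Lemma position_inj d v : {in [set w | e v w] &, injective (position d v)}.
Proof.
move=> u w; rewrite !inE => vu vw eq_pos; apply/eqP; apply: contraT.
by move=> /(precedes_total d) /orP[] /position_mono => [/(_ _ vu)|/(_ _ vw)];
  rewrite eq_pos ltnn.
Qed.

(** The positions of the neighbours of [v] are distinct and smaller than their
    number, hence take all the values below it. *)
Lemma position_surj d v k : k < #|[set w | e v w]| ->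
  exists2 w, e v w & position d v w = k.
Proof.
set S := [set w | e v w] => k_lt.
have sub : {subset map (position d v) (enum S) <= iota 0 #|S|}.
  move=> y /mapP[w]; rewrite mem_enum => Sw ->; rewrite mem_iota /=.
  apply/proper_card/properP; split; first by apply/subsetP=> x; rewrite !inE => /andP[].
  by exists w => //; rewrite !inE precedes_irr andbF.
have uniq_pos : uniq (map (position d v) (enum S)).
  rewrite map_inj_in_uniq ?enum_uniq // => u w; rewrite !mem_enum.
  exact: position_inj.
have [|_ eqS] := uniq_min_size uniq_pos sub; first by rewrite size_iota size_map cardE.
have: k \in iota 0 #|S| by rewrite mem_iota.
by rewrite -eqS => /mapP[w]; rewrite mem_enum inE => vw ->; exists w.
Qed.

Lemma position_ge d v w : #|[set u | e v u & d u < d w]| <= position d v w.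
Proof.
by apply/subset_leq_card/subsetP=> u; rewrite !inE /precedes => /andP[-> ->].
Qed.

Lemma position_lt d v w : e v w -> position d v w < #|[set u | e v u & d u <= d w]|.
Proof.
move=> vw; apply/proper_card/properP; split; last first.
  by exists w; rewrite !inE vw ?leqnn ?precedes_irr.
apply/subsetP=> u; rewrite !inE => /andP[-> /orP[/ltnW|/andP[/eqP->]]] //=.
Qed.

Lemma position_ltE d v w k : e v w ->
  (position d v w < #|[set u | e v u & d u <= k]|) = (d w <= k).
Proof.
move=> vw; apply/idP/idP => [|w_le].
  apply: contraTT; rewrite -ltnNge -leqNgt => k_lt.
  apply: leq_trans (position_ge _ _ _); apply/subset_leq_card/subsetP=> u.
  by rewrite !inE => /andP[-> /leq_ltn_trans->].
apply: leq_trans (position_lt d vw) _; apply/subset_leq_card/subsetP=> u.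
by rewrite !inE => /andP[-> /leq_trans->].
Qed.

Lemma tree_parking_lt pi v : rooted_tree pi -> tree_parking pi v < #|V|.
Proof.
move=> pi_tree; rewrite /tree_parking; case: ifP => [_|/negbT vq].
  by apply/card_gt0P; exists q.
have [_ /(_ _ vq) vpi _] := pi_tree.
exact: leq_trans (position_lt _ vpi) (max_card _).
Qed.

(** A vertex of least depth in [A] has its parent, and all the vertices met
    before that parent, outside [A]. *)
Lemma tree_parking_parking pi : rooted_tree pi -> parking (tree_parking pi).
Proof.
move=> pi_tree A a Aa qA.
case: (arg_minnP (depth pi) Aa) => v Av min_v; exists v => //.
have vq : v != q by apply: contraNneq qA => <-.
have [_ /(_ _ vq) vpi _] := pi_tree.
rewrite /tree_parking (negPf vq); apply: leq_trans (position_lt _ vpi) _.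
apply/subset_leq_card/subsetP=> u; rewrite !inE => /andP[-> /=] u_le.
apply: contraTN u_le => /min_v v_le; rewrite -ltnNge.
by apply: leq_trans v_le; rewrite (depth_parent _ vq).
Qed.

(** A vertex lies in the first [k.+2] layers exactly when it is ignited by the
    first [k.+1] of them, so [tree_parking] alone determines the layers. *)
Lemma tree_parking_layer pi v k : rooted_tree pi -> v != q ->
  (tree_parking pi v < #|[set u | e v u & depth pi u <= k]|) = (depth pi v <= k.+1).
Proof.
move=> pi_tree vq; have [_ /(_ _ vq) vpi _] := pi_tree.
by rewrite /tree_parking (negPf vq) position_ltE // (depth_parent _ vq).
Qed.

(** The parking function determines the layers of the tree one after the other,
    and then each parent through its position. *)
Lemma tree_parking_inj pi pi' : rooted_tree pi -> rooted_tree pi' ->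
  tree_parking pi =1 tree_parking pi' -> pi = pi'.
Proof.
move=> pi_tree pi'_tree eq_f.
have layer k v : (depth pi v <= k) = (depth pi' v <= k).
  elim: k v => [|k IHk] v; have [->|vq] := eqVneq v q; rewrite ?depth_root //.
    by rewrite !(depth_parent _ vq).
  rewrite -!tree_parking_layer // eq_f; congr (_ < _); apply: eq_card => u.
  by rewrite !inE IHk.
have eq_depth : depth pi = depth pi'.
  by apply: funext => v; apply/eqP; rewrite eqn_leq -layer leqnn layer leqnn.
have [piq pie _] := pi_tree; have [pi'q pi'e _] := pi'_tree.
apply/ffunP => v; have [->|vq] := eqVneq v q; first by rewrite piq.
apply: (@position_inj (depth pi) v); rewrite ?inE ?pie ?pi'e //.
by have := eq_f v; rewrite /tree_parking (negPf vq) -eq_depth.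
Qed.

(** Dhar's burning process: a vertex burns once more than [f v] of its
    neighbours have. *)
Definition burn f (X : {set V}) : {set V} :=
  q |: [set v | f v < #|[set w | e v w & w \in X]|].

Lemma burn_mono f : {homo burn f : X Y / X \subset Y}.
Proof.
move=> X Y XY; apply/setUS/subsetP => v; rewrite !inE => /leq_trans; apply.
by apply/subset_leq_card/subsetP => w; rewrite !inE => /andP[-> /(subsetP XY)].
Qed.

(** The unburnt set would otherwise contradict the parking condition. *)
Lemma burn_all f v : parking f -> v \in fixset (burn f).
Proof.
set Z := fixset _; have ZK : burn f Z = Z := fixsetK (@burn_mono f).
move=> park; apply: contraT => vZ.
have [||w] := park (~: Z) v; first by rewrite inE.
  by rewrite inE negbK -ZK !inE eqxx.
rewrite inE -{1}ZK !inE negb_or => /andP[_ /negP nlt] lt; case: nlt.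
by apply: leq_trans lt _; apply/subset_leq_card/subsetP=> u; rewrite !inE negbK.
Qed.

(** The vertices ignited at each stage form the layers of the tree: when [v]
    burns in layer [k.+1], [f v] lies between the number of its neighbours in
    the layers before [k] and in the layers up to [k], so the neighbour at
    position [f v] is in layer [k]; it is taken as the parent. *)
Lemma parking_tree_parking f : parking f ->
  exists2 pi, rooted_tree pi & forall v, v != q -> f v = tree_parking pi v.
Proof.
move=> park; pose mono := @burn_mono f; pose d v := (fix_order (burn f) v).-1.
have order_gt0 v : 0 < fix_order (burn f) v by rewrite fix_order_gt0 // burn_all.
have in_layer v k : (v \in iter k (burn f) set0) = (fix_order (burn f) v <= k).
  by rewrite in_iter_fixE // order_gt0.
have dq : d q = 0.
  by apply/eqP; rewrite -leqn0 /d -subn1 leq_subLR addn0 -in_layer !inE eqxx.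
have layer v k : v != q -> (d v <= k) = (f v < #|[set u | e v u & d u < k]|).
  move=> vq; rewrite -ltnS /d prednK // -in_layer /= !inE (negPf vq) /=.
  congr (_ < _); apply: eq_card => u; rewrite !inE in_layer.
  by rewrite prednK.
have dgt0 v : v != q -> 0 < d v.
  move=> vq; rewrite ltnNge layer // -leqNgt.
  by rewrite (_ : #|_| = 0) //; apply: eq_card0 => u; rewrite !inE andbF.
have /choice[p pP] v : exists w, v != q -> [/\ e v w, position d v w = f v & d v = (d w).+1].
  have [->|vq] := eqVneq v q; first by exists q.
  have [|w vw pos_w] := @position_surj d v (f v).
    have := leqnn (d v); rewrite {1}layer // => /leq_trans; apply.
    by apply/subset_leq_card/subsetP => u; rewrite !inE => /andP[].
  have shift j : (d v <= j.+1) = (d w <= j) by rewrite layer // -pos_w position_ltE.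
  exists w => _; split => //; apply/eqP.
  by rewrite eqn_leq shift leqnn /= -(prednK (dgt0 v vq)) ltnS -shift prednK ?dgt0.
pose pi := [ffun v => if v == q then q else p v].
have piE v : v != q -> [/\ e v (pi v), position d v (pi v) = f v & d v = (d (pi v)).+1].
  by move=> vq; rewrite ffunE (negPf vq); exact: pP.
have d_depth : depth_of pi d.
  by move=> v; have [->|/piE[_ _ ->]] := eqVneq v q.
exists pi => [|v vq].
  by split; [rewrite ffunE eqxx | move=> v /piE[] | exists d].
by rewrite /tree_parking (negPf vq) (depth_of_depth d_depth); have [_ -> _] := piE v vq.
Qed.

End ParkingFunctions.

(** * Rooted trees and spanning trees *)

Lemma connect_exit (V : finType) (e : rel V) (A : {set V}) u w :
  connect e u w -> u \in A -> w \notin A ->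
  exists v, v \in A /\ exists2 v', e v v' & v' \notin A.
Proof.
move=> /connectP[p]; elim: p u => [|x p IHp] u /=; first by move=> _ -> ->.
move=> /andP[ux xp] w_last uA wA; have [xA|xA] := boolP (x \in A).
  exact: IHp xp w_last xA wA.
by exists u; split=> //; exists x.
Qed.

Lemma connect_parking0 (V : finType) (e : rel V) q :
  (forall v, connect e v q) -> parking e q (fun=> 0).
Proof.
move=> conn A u uA qA; have [v [vA [w vw wA]]] := connect_exit (conn u) uA qA.
by exists v => //; apply/card_gt0P; exists w; rewrite inE vw.
Qed.

(** The burning process driven by the zero function is breadth-first search. *)
Lemma connect_rooted_tree (V : finType) (e : rel V) q :
  (forall v, connect e v q) -> exists pi, rooted_tree e q pi.
Proof.
by move=> /connect_parking0/parking_tree_parking[pi pi_tree _]; exists pi.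
Qed.

Lemma set2_eqP (V : finType) (a b c d : V) :
  [set a; b] = [set c; d] -> a = c /\ b = d \/ a = d /\ b = c.
Proof.
move=> eq2; have := set21 c d; have := set22 c d; rewrite -eq2 !inE.
have := set21 a b; have := set22 a b; rewrite eq2 !inE.
by do 4![case/orP=> /eqP ?]; subst; auto.
Qed.

Lemma edge_rel_sym n (F : {set {set 'I_n}}) : symmetric (edge_rel F).
Proof. by move=> u v; rewrite /edge_rel setUC. Qed.

Lemma edge_rel_edges n (e : rel 'I_n) (F : {set {set 'I_n}}) u v :
  symmetric e -> F \subset edges e -> edge_rel F u v -> e u v.
Proof.
move=> e_sym /subsetP sub /sub; rewrite inE => /existsP[a] /existsP[b] /andP[ab].
by move=> /eqP/set2_eqP[[-> ->]|[-> ->]] //; rewrite e_sym.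
Qed.

Section TreeEdges.

Variables (n : nat) (q : 'I_n).

Implicit Types (pi : {ffun 'I_n -> 'I_n}) (F : {set {set 'I_n}}).

Definition tree_edges pi : {set {set 'I_n}} :=
  [set [set v; pi v] | v in [set~ q]].

Lemma tree_edge pi v : v != q -> edge_rel (tree_edges pi) v (pi v).
Proof. by move=> vq; apply/imsetP; exists v; rewrite ?inE. Qed.

Lemma tree_edgeP pi u v : edge_rel (tree_edges pi) u v ->
  u != q /\ v = pi u \/ v != q /\ u = pi v.
Proof.
by move=> /imsetP[w]; rewrite !inE => wq /set2_eqP[[-> ->]|[-> ->]]; auto.
Qed.

Lemma tree_edges_connected (e : rel 'I_n) pi :
  rooted_tree e q pi -> connected_graph (edge_rel (tree_edges pi)).
Proof.
move=> pi_tree; split=> [|u v]; first exact: leq_ltn_trans (leq0n _) (ltn_ord q).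
have to_root w : connect (edge_rel (tree_edges pi)) w q.
  have [k] := ubnP (depth q pi w); elim: k w => // k IHk w.
  have [-> //|wq] := eqVneq w q; rewrite (depth_parent pi_tree wq) !ltnS => /IHk.
  exact/connect_trans/connect1/tree_edge.
apply: connect_trans (to_root u) _.
by rewrite (sym_connect_sym (edge_rel_sym _)).
Qed.

(** Both neighbours of a deepest vertex of a cycle would be its parent. *)
Lemma tree_edges_acyclic (e : rel 'I_n) pi :
  rooted_tree e q pi -> acyclic (edge_rel (tree_edges pi)).
Proof.
move=> pi_tree [//|z p0] sz /andP[].
have zp : z \in z :: p0 by exact: mem_head.
have [v vp max_v] := @arg_maxnP _ z (mem (z :: p0)) (depth q pi) zp.
have [i p def_p] := rot_to vp; rewrite -(rot_cycle i) -(rot_uniq i) def_p.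
move: sz; rewrite -(size_rot i) def_p.
case: p def_p => [|x p] //; case/lastP: p => // p y def_p _ /=.
rewrite !rcons_path last_rcons => /and3P[vx _ yv] /and3P[_ + _].
have mem_p w : (w \in z :: p0) = (w \in v :: x :: rcons p y) by rewrite -def_p mem_rot.
have parent w : w \in z :: p0 -> edge_rel (tree_edges pi) v w -> w = pi v.
  move=> /max_v le_w /tree_edgeP[[_ //]|[wq eq_v]].
  by move: le_w; rewrite /= (depth_parent pi_tree wq) -eq_v ltnn.
rewrite (parent x) ?mem_p ?inE ?eqxx ?orbT // (parent y) ?mem_p ?inE ?mem_rcons ?inE ?eqxx ?orbT //.
by rewrite edge_rel_sym.
Qed.

Lemma tree_edges_spanning_tree (e : rel 'I_n) pi :
  rooted_tree e q pi -> spanning_tree e (tree_edges pi).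
Proof.
move=> pi_tree; split; [|exact: tree_edges_connected pi_tree|exact: tree_edges_acyclic pi_tree].
apply/subsetP=> _ /imsetP[v /[!inE] vq ->]; have [_ /(_ _ vq) vpi _] := pi_tree.
by apply/existsP; exists v; apply/existsP; exists (pi v); rewrite vpi eqxx.
Qed.

(** Were the edge from [v] to its parent [pi v] directed the other way by
    [pi'], the edge from [pi v] to [pi (pi v)] would be reversed as well, and
    so on up to the root. *)
Lemma tree_edges_inj (e : rel 'I_n) pi pi' :
  rooted_tree e q pi -> rooted_tree e q pi' -> tree_edges pi = tree_edges pi' ->
  pi = pi'.
Proof.
move=> pi_tree [pi'q _ _] eqF; have [piq _ _] := pi_tree; apply/ffunP => v.
have [k] := ubnP (depth q pi v); elim: k v => // k IHk v.
have [-> _|vq] := eqVneq v q; first by rewrite piq.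
have /tree_edgeP[[_ ->//]|[wq eq_v]] : edge_rel (tree_edges pi') v (pi v).
  by rewrite -eqF tree_edge.
have depth_v := depth_parent pi_tree vq; rewrite depth_v ltnS => /IHk eq_w.
by move: depth_v; rewrite (depth_parent pi_tree wq) eq_w -eq_v; lia.
Qed.

(** Any tree contained in [F] and rooted at [q] exhausts [F], since one more
    edge closes a cycle with the tree path between its ends. *)
Lemma spanning_tree_rooted (e : rel 'I_n) F : symmetric e -> irreflexive e ->
  spanning_tree e F -> exists2 pi, rooted_tree e q pi & F = tree_edges pi.
Proof.
move=> e_sym e_irr [F_edges [_ F_conn] F_acyclic].
have [pi piF] := connect_rooted_tree (F_conn^~ q).
have [piq pi_edge pi_depth] := piF.
have pi_tree : rooted_tree e q pi.
  by split=> // v /pi_edge; exact: edge_rel_edges.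
exists pi => //; apply/eqP; rewrite eqEsubset andbC; apply/andP; split.
  by apply/subsetP=> _ /imsetP[v /[!inE] /pi_edge vF ->].
have subF : subrel (edge_rel (tree_edges pi)) (edge_rel F).
  by move=> u v /tree_edgeP[[/pi_edge uF ->]|[/pi_edge vF ->]] //; rewrite edge_rel_sym.
apply/subsetP => E EF; have := subsetP F_edges _ EF; rewrite inE.
move=> /existsP[u] /existsP[v] /andP[uv /eqP def_E]; apply: contraT => E_pi.
have [_ /(_ u v)] := tree_edges_connected pi_tree.
move=> /connectP[p0 p0_path] v_last; move: v_last E_pi uv EF; rewrite {}def_E.
case: (shortenP p0_path) => p p_path p_uniq _ -> E_pi uv EF.
case: (F_acyclic (u :: p)).
  case: p p_path {p_uniq} E_pi uv EF => [|x [|y p]] //=.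
    by rewrite e_irr.
  by rewrite andbT => ux /negP[].
by rewrite /ucycle p_uniq andbT /= rcons_path (sub_path subF) //= edge_rel_sym.
Qed.

Lemma num_spanning_treesE (e : rel 'I_n) : symmetric e -> irreflexive e ->
  num_spanning_trees e = #|[set pi | `[< rooted_tree e q pi >]]|.
Proof.
move=> e_sym e_irr; rewrite -[RHS](@card_in_imset _ _ tree_edges); last first.
  by move=> pi pi' /[!inE] /asboolP pi_tree /asboolP; exact: tree_edges_inj.
apply: eq_card => F; rewrite inE; apply/asboolP/imsetP => [|[pi /[!inE] /asboolP pi_tree ->]].
  by move=> /(spanning_tree_rooted e_sym e_irr)[pi /asboolP pi_tree ->]; exists pi; rewrite ?inE.
exact: tree_edges_spanning_tree.
Qed.

End TreeEdges.

(** * Chip firing and reduced divisors *)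

Local Open Scope ring_scope.

Section Laplacian.

Variables (V : finType) (e : rel V) (e_sym : symmetric e).

Implicit Types (s t : V -> int) (D : {ffun V -> int}).

Definition laplacian s v : int := \sum_(w | e v w) (s v - s w).

(** [s v] is the number of times that [v] is fired; it may be negative, which
    is harmless because firing every vertex once changes nothing. *)
Definition lin_equiv D D' : Prop := exists s, forall v, D' v = D v - laplacian s v.

Lemma laplacianD s t v : laplacian (fun w => s w + t w) v = laplacian s v + laplacian t v.
Proof. by rewrite -big_split; apply: eq_bigr => w _ /=; ring. Qed.

Lemma laplacianZ a s v : laplacian (fun w => a * s w) v = a * laplacian s v.
Proof. by rewrite /laplacian mulr_sumr; apply: eq_bigr => w _; ring. Qed.

Lemma laplacian_cst a v : laplacian (fun=> a) v = 0.
Proof. by rewrite /laplacian big1 // => w _; rewrite subrr. Qed.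

Lemma laplacian_adjoint s t :
  \sum_v t v * laplacian s v = \sum_v laplacian t v * s v.
Proof.
have expand a b : \sum_v a v * laplacian b v =
    \sum_v \sum_(w | e v w) a v * b v - \sum_v \sum_(w | e v w) a v * b w.
  rewrite -sumrB; apply: eq_bigr => v _; rewrite mulr_sumr -sumrB.
  by apply: eq_bigr => w _; ring.
have -> : \sum_v laplacian t v * s v = \sum_v s v * laplacian t v.
  by apply: eq_bigr => v _; rewrite mulrC.
rewrite !expand; congr (_ - _).
  by apply: eq_bigr => v _; apply: eq_bigr => w _; rewrite mulrC.
rewrite (exchange_big_dep predT) //=; apply: eq_bigr => v _.
by apply: eq_big => [w|w _]; [rewrite e_sym | rewrite mulrC].
Qed.

Lemma sum_laplacian s : \sum_v laplacian s v = 0.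
Proof.
have := laplacian_adjoint s (fun=> 1); under eq_bigr do rewrite mul1r.
by move=> ->; rewrite big1 // => v _; rewrite laplacian_cst mul0r.
Qed.

Lemma lin_equiv_refl D : lin_equiv D D.
Proof. by exists (fun=> 0) => v; rewrite laplacian_cst subr0. Qed.

Lemma lin_equiv_sym D D' : lin_equiv D D' -> lin_equiv D' D.
Proof.
move=> [s sP]; exists (fun v => - 1 * s v) => v.
by rewrite laplacianZ sP; ring.
Qed.

Lemma lin_equiv_trans D1 D2 D3 : lin_equiv D1 D2 -> lin_equiv D2 D3 -> lin_equiv D1 D3.
Proof.
move=> [s sP] [t tP]; exists (fun v => s v + t v) => v.
by rewrite laplacianD tP sP; ring.
Qed.

Lemma lin_equivD D D' E E' :
  lin_equiv D D' -> lin_equiv E E' -> lin_equiv (D + E) (D' + E').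
Proof.
move=> [s sP] [t tP]; exists (fun v => s v + t v) => v.
by rewrite !ffunE laplacianD tP sP; ring.
Qed.

Lemma lin_equiv_degree D D' : lin_equiv D D' -> \sum_v D' v = \sum_v D v.
Proof.
move=> [s sP]; under eq_bigr do rewrite sP.
by rewrite sumrB sum_laplacian subr0.
Qed.

Lemma laplacian_indic (A : {set V}) v : v \in A ->
  laplacian (fun w => (w \in A)%:R) v = (outdegree e A v)%:Z.
Proof.
move=> vA; rewrite /laplacian vA /outdegree -sum1dep_card -natz natr_sum.
rewrite big_mkcondr /=; apply: eq_bigr => w _.
by case: (w \in A); rewrite /= ?subrr ?subr0.
Qed.

Lemma laplacian_indic_le0 (A : {set V}) v : v \notin A ->
  laplacian (fun w => (w \in A)%:R) v <= 0.
Proof.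
move=> /negPf vA; apply: sumr_le0 => w _; rewrite vA.
by case: (w \in A).
Qed.

End Laplacian.

Section ReducedDivisors.

Variables (V : finType) (e : rel V) (e_sym : symmetric e) (q : V).
Hypothesis e_conn : forall v, connect e v q.

Implicit Types (D : {ffun V -> int}) (pi : {ffun V -> V}).

(** Powers of a base larger than all degrees, decreasing with the depth of a
    spanning tree, make the parent of [v] outweigh all the other neighbours. *)
Lemma exists_potential : exists h : V -> nat,
  h q = 0%N /\ forall v, v != q -> 0 < laplacian e (fun w => (h w)%:Z) v.
Proof.
have [pi pi_tree] := connect_rooted_tree e_conn.
pose B := #|V|.+1; pose m := (\sum_v depth q pi v)%N.
pose p v := (B ^ (m - depth q pi v))%N.
exists (fun v => (B ^ m - p v)%N); split.
  by rewrite /p (depth_root pi_tree) subn0 subnn.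
move=> v vq; have [_ /(_ _ vq) vpi _] := pi_tree.
have p_le w : (p w <= B ^ m)%N by rewrite leq_pexp2l // leq_subr.
have le_m : (depth q pi v <= m)%N by rewrite /m (bigD1 v) //= leq_addr.
have p_parent : p (pi v) = (B * p v)%N.
  rewrite /p -expnS; congr (B ^ _)%N.
  by rewrite (depth_parent pi_tree vq) in le_m *; lia.
have -> : laplacian e (fun w => (B ^ m - p w)%N%:Z) v =
    \sum_(w | e v w) (p w)%:Z - \sum_(w | e v w) (p v)%:Z.
  rewrite -sumrB; apply: eq_bigr => w _.
  by rewrite -!subzn //; ring.
rewrite subr_gt0; apply: (@lt_le_trans _ _ (p (pi v))%:Z); last first.
  by rewrite (bigD1 (pi v)) //= lerDl sumr_ge0.
rewrite sumr_const -mulr_natr p_parent mulrC natz -PoszM ltz_nat ltn_pmul2r.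
  by rewrite ltnS max_card.
by rewrite expn_gt0.
Qed.

Definition reduced D : Prop :=
  (forall v, v != q -> 0 <= D v) /\ parking e q (fun v => `|D v|%N).

(** Firing the script [N h] backwards, where [h] is a potential, removes every
    debt outside [q]; after that, firing the sets which violate the parking
    condition creates no debt and lowers the total potential. *)
Lemma lin_equiv_reduced D : exists2 D', lin_equiv e D D' & reduced D'.
Proof.
have [h [hq h_gt0]] := exists_potential; pose hz w := (h w)%:Z.
have : exists2 D', lin_equiv e D D' & forall v, v != q -> 0 <= D' v.
  pose N : int := \sum_v `|D v|; pose s w := - N * hz w.
  exists [ffun v => D v - laplacian e s v]; first by exists s => v; rewrite ffunE.
  move=> v vq; rewrite ffunE laplacianZ mulNr opprK.
  have N_ge : `|D v| <= N by rewrite /N (bigD1 v) //= lerDl sumr_ge0.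
  by have := h_gt0 v vq; rewrite -/hz => ?; nia.
move=> [D0 DD0 D0_ge0].
suff /(_ D0 D0_ge0)[D' D0D' D'_red] : forall D1, (forall v, v != q -> 0 <= D1 v) ->
    exists2 D', lin_equiv e D1 D' & reduced D'.
  by exists D' => //; apply: lin_equiv_trans DD0 D0D'.
move=> D1; have [k] := ubnP (absz (\sum_v hz v * D1 v)).
elim: k D1 => // k IHk D1; rewrite ltnS => pot_le D1_ge0.
have [park|] := pselect (parking e q (fun v => `|D1 v|%N)).
  by exists D1; [exact: lin_equiv_refl | split].
move=> /existsNP[A] /existsNP[u] /not_implyP[uA] /not_implyP[qA no_v].
have A_q v : v \in A -> v != q by apply: contraTneq => ->.
have A_rich v : v \in A -> (outdegree e A v)%:Z <= D1 v.
  move=> vA; have := D1_ge0 v (A_q v vA).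
  case: (ltnP `|D1 v|%N (outdegree e A v)) => [lt|]; last by lia.
  by case: no_v; exists v.
pose s w : int := (w \in A)%:R.
pose D2 := [ffun v => D1 v - laplacian e s v].
have D1D2 : lin_equiv e D1 D2 by exists s => v; rewrite ffunE.
have D2_ge0 v : v != q -> 0 <= D2 v.
  move=> vq; rewrite ffunE subr_ge0; have [vA|vA] := boolP (v \in A).
    by rewrite laplacian_indic // A_rich.
  exact: le_trans (laplacian_indic_le0 e vA) (D1_ge0 v vq).
have pot_ge0 D3 : (forall v, v != q -> 0 <= D3 v) -> 0 <= \sum_v hz v * D3 v.
  move=> D3_ge0; apply: sumr_ge0 => v _; have [->|vq] := eqVneq v q.
    by rewrite /hz hq mul0r.
  by rewrite mulr_ge0 // D3_ge0.
have pot_lt : \sum_v hz v * D2 v < \sum_v hz v * D1 v.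
  have -> : \sum_v hz v * D2 v = \sum_v hz v * D1 v - \sum_v laplacian e hz v * s v.
    rewrite -laplacian_adjoint // -sumrB; apply: eq_bigr => v _.
    by rewrite ffunE mulrBr.
  rewrite ltrBlDr ltrDl (bigD1 u) //= /s uA mulr1.
  apply: ltr_wpDr; last by apply: h_gt0; exact: A_q.
  apply: sumr_ge0 => v _; case: (boolP (v \in A)) => [/A_q/h_gt0/ltW|_].
    by rewrite mulr1.
  by rewrite mulr0.
have [|D' D2D' D'_red] := IHk D2 _ D2_ge0.
  move: (pot_ge0 _ D1_ge0) (pot_ge0 _ D2_ge0) pot_lt pot_le.
  move: (\sum_v _) (\sum_v _) => a b; lia.
by exists D' => //; apply: lin_equiv_trans D1D2 D2D'.
Qed.

(** Otherwise the vertices fired most often would, as a set, be fired legally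
    from [D], against the parking condition. *)
Lemma reduced_max_root (D D' : {ffun V -> int}) s :
  parking e q (fun v => `|D v|%N) -> (forall v, v != q -> 0 <= D' v) ->
  (forall v, D' v = D v - laplacian e s v) -> forall v, s v <= s q.
Proof.
move=> park D'_ge0 DD'; have [m _ max_m] := @arg_maxP _ _ _ q xpredT s isT.
suff -> : s q = s m by move=> v; exact: max_m.
apply/eqP; apply: contraT => smq.
have [||v] := park [set v | s v == s m] m; rewrite ?inE //.
move=> /eqP sv lt_out; have vq : v != q by apply: contraNneq smq => <-; rewrite sv.
have := D'_ge0 v vq; rewrite DD'.
suff : (outdegree e [set v | s v == s m] v)%:Z <= laplacian e s v by lia.
rewrite /outdegree -sum1dep_card -natz natr_sum big_mkcondr /=.
apply: ler_sum => w _; rewrite inE sv; have := max_m w isT.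
by case: eqP => [->|] /=; lia.
Qed.

Lemma reduced_unique D D' : reduced D -> reduced D' -> lin_equiv e D D' -> D = D'.
Proof.
move=> [D_ge0 D_park] [D'_ge0 D'_park] [s DD'].
have s_le := reduced_max_root D_park D'_ge0 DD'.
have s_ge v : s q <= s v.
  suff : - 1 * s v <= - 1 * s q by rewrite !mulN1r lerN2.
  apply: (@reduced_max_root D' D (fun w => - 1 * s w)) => // w.
  by rewrite laplacianZ DD'; ring.
apply/ffunP => v; rewrite DD' /laplacian big1 ?subr0 // => w _.
have eq_s u : s u = s q by apply/eqP; rewrite eq_le s_le s_ge.
by rewrite !eq_s subrr.
Qed.

(** The tree prescribes the values outside [q]; the value at [q] makes up the
    degree and may be negative. *)
Definition tree_divisor pi (c : int) : {ffun V -> int} :=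
  [ffun v => if v == q then c - \sum_w (tree_parking e q pi w)%:Z
             else (tree_parking e q pi v)%:Z].

Lemma tree_divisor_degree pi c : \sum_v tree_divisor pi c v = c.
Proof.
rewrite (bigD1 q) //= ffunE eqxx (bigD1 q) //= {1}/tree_parking eqxx add0r.
rewrite -[RHS](subrK (\sum_(w | w != q) (tree_parking e q pi w)%:Z)).
by congr (_ + _); apply: eq_bigr => v /negPf vq; rewrite ffunE vq.
Qed.

Lemma eq_parking f g : (forall v, v != q -> f v = g v) ->
  parking e q f -> parking e q g.
Proof.
move=> eq_fg park A u uA qA; have [v vA lt] := park A u uA qA.
by exists v => //; rewrite -eq_fg //; apply: contraNneq qA => <-.
Qed.

Lemma tree_divisor_reduced pi c : rooted_tree e q pi -> reduced (tree_divisor pi c).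
Proof.
move=> pi_tree; split=> [v /negPf vq|]; first by rewrite ffunE vq.
apply: eq_parking (tree_parking_parking pi_tree) => v /negPf vq.
by rewrite ffunE vq.
Qed.

Lemma lin_equiv_tree_divisor D :
  exists2 pi, rooted_tree e q pi & lin_equiv e D (tree_divisor pi (\sum_v D v)).
Proof.
have [D' DD' [D'_ge0 D'_park]] := lin_equiv_reduced D.
have [pi pi_tree D'E] := parking_tree_parking D'_park; exists pi => //.
suff <- : D' = tree_divisor pi (\sum_v D v) by [].
have eq_off v : v != q -> D' v = tree_divisor pi (\sum_v D v) v.
  by move=> vq; rewrite ffunE (negPf vq) -D'E // gez0_abs ?D'_ge0.
apply/ffunP => v; have [->|/eq_off//] := eqVneq v q.
have := lin_equiv_degree e_sym DD'; rewrite -[RHS](tree_divisor_degree pi).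
by rewrite (bigD1 q) //= [RHS](bigD1 q) //= (eq_bigr _ eq_off) => /addIr.
Qed.

Lemma tree_divisor_inj pi pi' c : rooted_tree e q pi -> rooted_tree e q pi' ->
  lin_equiv e (tree_divisor pi c) (tree_divisor pi' c) -> pi = pi'.
Proof.
move=> pi_tree pi'_tree.
move=> /(reduced_unique (tree_divisor_reduced _ pi_tree) (tree_divisor_reduced _ pi'_tree)).
move=> /ffunP eqD; apply: (tree_parking_inj pi_tree pi'_tree) => v.
have := eqD v; rewrite !ffunE; case: eqP => [-> _|_ [//]].
by rewrite /tree_parking eqxx.
Qed.

(** Parking functions of trees take values below the number of vertices, so a
    large degree leaves no debt at [q]. *)
Lemma tree_divisor_ge0 pi (c : int) v : rooted_tree e q pi ->
  (#|V| * #|V|)%N%:Z <= c -> 0 <= tree_divisor pi c v.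
Proof.
move=> pi_tree c_ge; rewrite ffunE; case: ifP => // _; rewrite subr_ge0.
apply: le_trans c_ge; rewrite PoszM -[X in _ * X]natz mulr_natr -sumr_const.
by apply: ler_sum => w _; rewrite lez_nat ltnW // tree_parking_lt.
Qed.

End ReducedDivisors.

(** * Counting effective divisors class by class *)

Section Counting.

Variables (n : nat) (e : rel 'I_n).
Hypotheses (e_sym : symmetric e) (e_irr : irreflexive e).

Implicit Types (D : {ffun 'I_n -> int}) (C : config n).

Lemma fireE D i j : fire e D i j = D j - laplacian e (fun w => (w == i)%:R) j.
Proof.
rewrite ffunE; have [->|ji] := eqVneq j i.
  rewrite e_irr addr0; congr (_ - _); rewrite /laplacian eqxx.
  rewrite /degree -sum1dep_card -natz natr_sum; apply: eq_bigr => w iw.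
  by have [eq_w|_] := eqVneq w i; [rewrite eq_w e_irr in iw | rewrite subr0].
rewrite subr0 /laplacian (negPf ji); congr (_ + _); rewrite e_sym.
case: ifP => [ij|/negP ij]; last first.
  by rewrite big1 ?oppr0 // => w iw; have [eq_w|] := eqVneq w i; rewrite // -eq_w in ij.
rewrite (bigD1 i) //= eqxx big1 ?addr0 ?sub0r ?opprK // => w /andP[_ /negPf->].
by rewrite subrr.
Qed.

Lemma foldl_fire s D j :
  foldl (fire e) D s j = D j - laplacian e (fun w => (count_mem w s)%:Z) j.
Proof.
elim: s D => [|i s IHs] D /=; first by rewrite laplacian_cst subr0.
rewrite IHs fireE -addrA -opprD -laplacianD; congr (_ - _).
by apply: eq_bigr => w _; rewrite !PoszD !natz ![i == _]eq_sym.
Qed.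

(** A firing script becomes nonnegative after adding a constant, and can then
    be carried out vertex by vertex. *)
Lemma debt_reachableP C C' :
  debt_reachable e C C' <-> lin_equiv e (int_config C) (int_config C').
Proof.
split=> [[s def_C']|[s def_C']].
  by exists (fun w => (count_mem w s)%:Z) => v; rewrite -def_C' foldl_fire.
pose N : int := \sum_v `|s v|; pose t v := absz (s v + N).
have tE v : (t v)%:Z = s v + N.
  have : `|s v| <= N by rewrite /N (bigD1 v) //= lerDl sumr_ge0.
  by rewrite /t; lia.
exists (flatten [seq nseq (t v) v | v <- enum 'I_n]); apply/ffunP => j.
rewrite foldl_fire def_C'; congr (_ - _); rewrite -[RHS]addr0 -(laplacian_cst e N j).
rewrite -laplacianD; apply: eq_bigr => w _; rewrite -!tE.
have cnt v : count_mem v (flatten [seq nseq (t v) v | v <- enum 'I_n]) = t v.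
  rewrite count_flatten -map_comp sumnE big_map big_enum /= (bigD1 v) //=.
  rewrite count_nseq /= eqxx mul1n big1 ?addn0 // => u /negPf uv.
  by rewrite count_nseq /= uv.
by rewrite !cnt.
Qed.

Lemma int_config_degree C : \sum_v int_config C v = (total_chips C)%:Z.
Proof. by rewrite -natz natr_sum; apply: eq_bigr => v _; rewrite ffunE natz. Qed.

Lemma finite_total_chips c : finite_set [set C : config n | total_chips C = c]%classic.
Proof.
pose f (g : {ffun 'I_n -> 'I_c.+1}) : config n := [ffun i => g i : nat].
apply: (@sub_finite_set _ _ (range f)); last exact/finite_image/finite_finset.
move=> C /= eqC; exists [ffun i => inord (C i)] => //.
apply/ffunP => i; rewrite !ffunE inordK // ltnS -eqC /total_chips (bigD1 i) //=.
exact: leq_addr.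
Qed.

Definition all_configs (c : nat) : {fset config n} :=
  fset_set [set C : config n | total_chips C = c]%classic.

Lemma in_all_configs c C : (C \in all_configs c) = (total_chips C == c).
Proof.
rewrite in_fset_set; last exact: finite_total_chips.
by apply/idP/eqP; rewrite in_setE.
Qed.

Lemma card_all_configs c : (0 < n)%N -> #|` all_configs c| = 'C(c + n.-1, n.-1).
Proof.
move=> n_gt0; rewrite addnC -card_ord_partitions prednK //.
set P := [set _ | _]; pose f (t : n.-tuple 'I_c.+1) : config n := [ffun i => tnth t i : nat].
have f_inj : injective f.
  move=> t t' /ffunP eq_f; apply: eq_from_tnth => i; apply: val_inj.
  by have := eq_f i; rewrite !ffunE.
have total_f t : total_chips (f t) = (\sum_(i <- t) i)%N.
  by rewrite big_tuple; apply: eq_bigr => i _; rewrite ffunE.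
transitivity #|` [fset f t | t in P]%fset|; last by rewrite card_imfset //= -cardE.
congr #|` _|.
apply/fsetP => C; rewrite in_all_configs; apply/eqP/imfsetP => /= [eqC|[t]].
  have CE : C = f [tuple inord (C i) | i < n].
    apply/ffunP => i; rewrite ffunE tnth_mktuple inordK // ltnS -eqC.
    by rewrite /total_chips (bigD1 i) //= leq_addr.
  exists [tuple inord (C i) | i < n] => //.
  by rewrite inE -total_f -CE eqC.
by rewrite inE => /eqP <- ->; rewrite total_f.
Qed.

Definition num_effective D : nat :=
  #|` fset_set [set C : config n | lin_equiv e D (int_config C)]%classic|.

Lemma lin_equiv_total_chips D C :
  lin_equiv e D (int_config C) -> (total_chips C)%:Z = \sum_v D v.
Proof. by move=> /(lin_equiv_degree e_sym); rewrite int_config_degree. Qed.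

Lemma finite_effective D : finite_set [set C : config n | lin_equiv e D (int_config C)]%classic.
Proof.
apply: sub_finite_set (finite_total_chips (absz (\sum_v D v))) => C /=.
by move=> /lin_equiv_total_chips <-.
Qed.

Lemma in_effective D C :
  (C \in fset_set [set C : config n | lin_equiv e D (int_config C)]%classic) =
  `[< lin_equiv e D (int_config C) >].
Proof.
rewrite in_fset_set; last exact: finite_effective.
by apply/idP/asboolP; rewrite in_setE.
Qed.

Lemma num_debt_reachableE C : num_debt_reachable e C = num_effective (int_config C).
Proof.
rewrite /num_debt_reachable /num_effective; congr #|` fset_set _|.
by apply/seteqP; split=> C' /= /debt_reachableP.
Qed.

Variable q : 'I_n.
Hypothesis e_conn : forall v, connect e v q.

(** If the difference of two divisors has degree at least [n * n], it is
    equivalent to an effective divisor, and adding the latter embeds one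
    class in the other. *)
Lemma num_effective_le D D' :
  (n * n)%N%:Z <= \sum_v D' v - \sum_v D v -> (num_effective D <= num_effective D')%N.
Proof.
move=> deg_le; have [pi pi_tree E_equiv] := lin_equiv_tree_divisor e_sym e_conn (D' - D).
have [E EE] : exists E : config n, tree_divisor e q pi (\sum_v (D' - D) v) = int_config E.
  have T_ge0 v : 0 <= tree_divisor e q pi (\sum_v (D' - D) v) v.
    apply: tree_divisor_ge0 => //; rewrite card_ord; apply: le_trans deg_le _.
    rewrite -sumrB le_eqVlt; apply/orP; left; apply/eqP.
    by apply: eq_bigr => w _; rewrite !ffunE.
  move: (tree_divisor _ _ _ _) T_ge0 => T T_ge0; exists [ffun v => absz (T v)].
  by apply/ffunP => v; rewrite !ffunE gez0_abs.
rewrite EE in E_equiv; pose add C : config n := [ffun v => (C v + E v)%N].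
have add_inj : injective add.
  by move=> C C' /ffunP eqC; apply/ffunP => v; have := eqC v; rewrite !ffunE => /addIn.
rewrite {1}/num_effective; set A := fset_set _.
have <- : #|` [fset add C | C in A]%fset| = #|` A| by rewrite card_imfset.
apply: fsubset_leq_card.
apply/fsubsetP => _ /imfsetP[C + ->]; rewrite /= !in_effective => /asboolP DC.
apply/asboolP; have := lin_equivD DC E_equiv; rewrite addrCA subrr addr0.
by congr (lin_equiv e _ _); apply/ffunP => v; rewrite !ffunE PoszD.
Qed.

(** Each configuration is equivalent to exactly one reduced divisor, and the
    reduced divisors of a given degree correspond to the rooted trees. *)
Lemma sum_num_effective (c : nat) :
  (\sum_(pi in [set pi | `[< rooted_tree e q pi >]])
     num_effective (tree_divisor e q pi c%:Z))%N = #|` all_configs c|.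
Proof.
have /choice[cls clsP] C : exists pi, rooted_tree e q pi /\
    lin_equiv e (int_config C) (tree_divisor e q pi (total_chips C)%:Z).
  have [pi pi_tree] := lin_equiv_tree_divisor e_sym e_conn (int_config C).
  by rewrite int_config_degree; exists pi.
rewrite -sum1_size (partition_big cls [in [set pi | `[< rooted_tree e q pi >]]]) /=; last first.
  by move=> C _; rewrite inE; apply/asboolP; have [] := clsP C.
apply: eq_bigr => pi /[!inE] /asboolP pi_tree; rewrite sum1_count -size_filter.
apply/perm_size/uniq_perm; rewrite ?filter_uniq ?fset_uniq // => C.
rewrite mem_filter in_effective in_all_configs /=.
have [cls_tree C_cls] := clsP C.
apply/asboolP/andP => [piC|[/eqP eq_pi /eqP eq_c]]; last first.
  by apply: lin_equiv_sym; rewrite -eq_pi -eq_c.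
have eq_c : total_chips C = c.
  by have := lin_equiv_total_chips piC; rewrite tree_divisor_degree => -[].
split; apply/eqP => //; apply: (tree_divisor_inj (c := c%:Z) cls_tree pi_tree).
by apply: lin_equiv_sym; apply: lin_equiv_trans piC _; rewrite -eq_c.
Qed.

(** Compare the class of [C] with each class of degree [c + n * n], then with
    each class of degree [c - n * n], and sum over the spanning trees. *)
Lemma num_effective_bounds (C : config n) (c := total_chips C) :
  (num_spanning_trees e * num_effective (int_config C) <= 'C(c + n * n + n.-1, n.-1))%N /\
  ((n * n <= c)%N ->
    'C(c - n * n + n.-1, n.-1) <= num_spanning_trees e * num_effective (int_config C))%N.
Proof.
have n_gt0 : (0 < n)%N by apply: leq_ltn_trans (ltn_ord q).
rewrite (num_spanning_treesE q e_sym e_irr) -sum_nat_const -!card_all_configs //.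
rewrite -!sum_num_effective; split=> [|c_ge]; apply: leq_sum => pi _;
  apply: num_effective_le; rewrite tree_divisor_degree int_config_degree.
  by rewrite PoszD; lia.
by rewrite -/c -subzn //; lia.
Qed.

End Counting.

(** * The asymptotic estimate *)

Lemma bin_fact_bounds m k : (m ^ k <= 'C(m + k, k) * k`! <= (m + k) ^ k)%N.
Proof.
rewrite bin_ffact ffact_prod -[X in (_ ^ X <= _)%N]card_ord -prod_nat_const.
rewrite -[X in (_ <= _ ^ X)%N]card_ord -prod_nat_const.
by apply/andP; split; apply: leq_prod => i _; have := ltn_ord i; lia.
Qed.

Local Open Scope classical_set_scope.

Lemma cvg_1_plus_inv_pow (R : realType) (a : R) k :
  (fun c : nat => (1 + a * (c%:R)^-1) ^+ k : R) @ \oo --> (1 : R).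
Proof.
have inv0 : (fun c : nat => (c%:R)^-1 : R) @ \oo --> (0 : R).
  apply/gtr0_cvgV0; last exact: cvgr_idn.
  by exists 1%N => // c /= c_gt0; rewrite ltr0n.
have lin1 : (fun c : nat => 1 + a * (c%:R)^-1 : R) @ \oo --> (1 : R).
  rewrite -[X in _ --> X]addr0 -[X in 1 + X](mulr0 a).
  by apply: cvgD; [exact: cvg_cst | apply: cvgMr].
rewrite -[X in _ --> X](expr1n R k).
exact: (cvg_comp _ (fun x : R => x ^+ k) lin1 (@exprn_continuous R k 1)).
Qed.

Theorem theorem4p9 (R : realType) (n : nat) (e : rel 'I_n)
    (esym : symmetric e) (eirr : irreflexive e) (econn : connected_graph e)
    (X : nat -> config n) (Xtotal : forall c : nat, (1 <= c)%N -> total_chips (X c) = c) :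
  (fun c : nat =>
     (num_debt_reachable e (X c))%:R
       / ((c%:R ^+ (n - 1)) / (((n - 1)`!)%:R * (num_spanning_trees e)%:R)) : R)
    @ \oo --> (1 : R).
Proof.
have [n_gt0 conn] := econn; pose q := Ordinal n_gt0.
have bounds c := num_effective_bounds esym eirr (conn^~ q) (X c).
rewrite subn1; set k := n.-1 in bounds *; set M := (n * n)%N in bounds *.
apply: (@squeeze_cvgr _ _ _ R (fun c : nat => (1 + - M%:R * (c%:R)^-1) ^+ k)
  (fun c : nat => (1 + (M + k)%:R * (c%:R)^-1) ^+ k)); first last.
- exact: cvg_1_plus_inv_pow.
- exact: cvg_1_plus_inv_pow.
exists M.+1 => // c /= c_gt; have c_gt0 : (0 < c)%N by apply: leq_trans c_gt.
have c_ge : (M <= c)%N := ltnW c_gt.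
have := bounds c; rewrite -num_debt_reachableE // Xtotal //.
set N := num_debt_reachable _ _; set K := num_spanning_trees e => -[upper /(_ c_ge) lower].
have K_gt0 : (0 < K)%N.
  by apply: contraTltn lower; rewrite leqn0 => /eqP->; rewrite mul0n leqn0 -lt0n bin_gt0 leq_addl.
have cR : (c%:R : R) != 0 by rewrite pnatr_eq0 -lt0n.
have KR : (K%:R : R) != 0 by rewrite pnatr_eq0 -lt0n.
have -> : N%:R / (c%:R ^+ k / (k`!%:R * K%:R)) = (K * N * k`!)%N%:R / c%:R ^+ k :> R.
  by rewrite invf_div !natrM; ring.
rewrite ler_pdivlMr ?ler_pdivrMr ?exprn_gt0 ?ltr0n // -!exprMn !mulrDl !mul1r.
rewrite !mulfVK // -natrD -natrB // -!natrX !ler_nat.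
have [lower_bin _] := andP (bin_fact_bounds (c - M) k).
have [_ upper_bin] := andP (bin_fact_bounds (c + M) k).
rewrite addnA (leq_trans lower_bin) ?(leq_trans _ upper_bin) // leq_mul2r.
  by rewrite upper orbT.
by rewrite lower orbT.
Qed.
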